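(* Let $A$ be a distributive lattice, let $\mathbb{S} = (A, \prec)$ be any subordination algebra and let $\mathbb{A} = (A, \Rightarrow)$ be any slanted Heyting algebra. Then, for all $a,b,c \in A$: (i) $c\leq a\Rightarrow_{\prec} b$ if and only if $a\wedge c\prec b$; (ii) $\mathbb{S}_\ast = (A, \Rightarrow_{\prec})$ is a slanted Heyting algebra; (iii) $\mathbb{A}^\ast = (A, \prec_{\Rightarrow})$ is a subordination algebra; (iv) $a \prec_{\Rightarrow_{\prec}} b$ if and only if $a\prec b$, and $a \Rightarrow_{\prec_{\Rightarrow}} b = a\Rightarrow b$.
   Context: Lattices are bounded. For a lattice $A$, its canonical extension $A^\delta$ is the (unique up to isomorphism fixing $A$) complete lattice containing $A$ as a dense and compact sublattice. Here an element of $A^\delta$ is closed if it is $\bigwedge F$ for some nonempty $F\subseteq A$, and open if it is $\bigvee I$ for some nonempty $I\subseteq A$; $K(A^\delta)$ and $O(A^\delta)$ denote the sets of closed and open elements. Dense: every element of $A^\delta$ is both a join of closed elements and a meet of open elements. Compact: for all nonempty $F, I\subseteq A$, if $\bigwedge F\leq\bigvee I$ then $\bigwedge F'\leq \bigvee I'$ for some finite $F'\subseteq F$, $I'\subseteq I$. A subordination algebra is a pair $(A,\prec)$ where $A$ is a distributive lattice and ${\prec}\subseteq A\times A$ satisfies, for all $a,b,c,d\in A$: $\bot\prec\bot$ and $\top\prec\top$; if $a\prec b$ and $a\prec c$ then $a\prec b\wedge c$; if $a\prec c$ and $b\prec c$ then $a\vee b\prec c$; if $a\leq b\prec c\leq d$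 then $a\prec d$. A slanted Heyting algebra is a pair $(A,\Rightarrow)$ where $A$ is a distributive lattice and $\Rightarrow\,: A\times A\to A^\delta$ satisfies, for all $a,a_1,a_2,b,b_1,b_2,c\in A$: (1) $a\Rightarrow b\in O(A^\delta)$; (2) $a\Rightarrow(b_1\wedge b_2)=(a\Rightarrow b_1)\wedge(a\Rightarrow b_2)$ and $a\Rightarrow\top=\top$; (3) $(a_1\vee a_2)\Rightarrow b=(a_1\Rightarrow b)\wedge(a_2\Rightarrow b)$ and $\bot\Rightarrow b=\top$; (4) $c\leq a\Rightarrow b$ iff $a\wedge c\leq\top\Rightarrow b$. For a subordination algebra $(A,\prec)$, define $\Rightarrow_{\prec}\,: A\times A\to A^\delta$ by $a\Rightarrow_{\prec} b:=\bigvee\{c\in A\mid a\wedge c\prec b\}$ (join taken in $A^\delta$). For a slanted Heyting algebra $(A,\Rightarrow)$, define the relation $\prec_{\Rightarrow}$ on $A$ by: $a\prec_{\Rightarrow} b$ iff $a\leq\top\Rightarrow b$. The relation $\prec_{\Rightarrow_\prec}$ is obtained by applying the second construction to $\Rightarrow_{\prec}$, and $\Rightarrow_{\prec_\Rightarrow}$ by applying the first construction to $\prec_{\Rightarrow}$. *)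

(* Defs.v *)
From mathcomp Require Import all_boot all_order.
From mathcomp Require Import boolp classical_sets functions cardinality.

Set Implicit Arguments.
Unset Strict Implicit.
Unset Printing Implicit Defensive.

Import Order.TTheory.

Local Open Scope classical_set_scope.
Local Open Scope order_scope.

Definition complete_lattice d (C : tbLatticeType d) : Prop :=
  forall S : set C, supremums S !=set0 /\ infimums S !=set0.

(* [supremum \bot] and [infimum \top] send [set0] to the right value; on a set
   without a supremum (infimum) the value is a default one, so these are only
   meaningful when [C] is complete. *)
Definition bigjoin d (C : tbLatticeType d) (S : set C) : C := supremum \bot S.
Definition bigmeet d (C : tbLatticeType d) (S : set C) : C := infimum \top S.

Section CanonicalExtension.
Context d (A : tbDistrLatticeType d) d' (C : tbLatticeType d').
Context (e : {lmorphism A -> C}).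

Definition closed_elt (u : C) : Prop :=
  exists2 F : set A, F !=set0 & u = bigmeet (e @` F).

Definition open_elt (u : C) : Prop :=
  exists2 I : set A, I !=set0 & u = bigjoin (e @` I).

Definition dense_ext : Prop :=
  forall u : C,
    (exists2 S : set C, S `<=` closed_elt & u = bigjoin S) /\
    (exists2 S : set C, S `<=` open_elt & u = bigmeet S).

Definition compact_ext : Prop :=
  forall F I : set A, F !=set0 -> I !=set0 ->
    bigmeet (e @` F) <= bigjoin (e @` I) ->
    exists F' I' : set A,
      [/\ finite_set F', F' `<=` F, finite_set I', I' `<=` I
        & bigmeet (e @` F') <= bigjoin (e @` I')].

(* [A] is identified with the sublattice [range e] of [C]; [{tblmorphism _}] is
   not used because it only asks for preservation of the bounds. *)
Definition bounded_sublattice : Prop :=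
  [/\ injective e, e \bot = \bot & e \top = \top].

Definition canonical_extension : Prop :=
  [/\ complete_lattice C, bounded_sublattice, dense_ext & compact_ext].

Record slanted_heyting (imp : A -> A -> C) : Prop := SlantedHeyting {
  slanted_open : forall a b, open_elt (imp a b);
  slanted_meetr : forall a b1 b2, imp a (b1 `&` b2) = imp a b1 `&` imp a b2;
  slanted_topr : forall a, imp a \top = \top;
  slanted_joinl : forall a1 a2 b, imp (a1 `|` a2) b = imp a1 b `&` imp a2 b;
  slanted_botl : forall b, imp \bot b = \top;
  slanted_residual : forall a b c,
    (e c <= imp a b) <-> (e (a `&` c) <= imp \top b)
}.

Definition slanted_of_subord (prec : A -> A -> Prop) (a b : A) : C :=
  bigjoin (e @` [set c | prec (a `&` c) b]).

Definition subord_of_slanted (imp : A -> A -> C) (a b : A) : Prop :=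
  e a <= imp \top b.

End CanonicalExtension.

Record subordination d (A : tbDistrLatticeType d) (prec : A -> A -> Prop) :
    Prop := Subordination {
  subord_bot : prec \bot \bot;
  subord_top : prec \top \top;
  subord_meet : forall a b c, prec a b -> prec a c -> prec a (b `&` c);
  subord_join : forall a b c, prec a c -> prec b c -> prec (a `|` b) c;
  subord_mono : forall a b c d, a <= b -> prec b c -> c <= d -> prec a d
}.

(* Main.v *)
(* By compactness, a closed element below an open one is separated from it by an
   element of [A].  Hence [c <= \bigvee I] iff [c \in I] for [c : A] and an ideal
   [I] of [A], and inequalities between finite meets of open elements and
   arbitrary elements can be tested on [A]; all the claims then follow by
   comparing the elements of [A] below both sides. *)
Require Import Defs.
From mathcomp Require Import all_boot all_order.
From mathcomp Require Import boolp classical_sets functions cardinality.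

Set Implicit Arguments.
Unset Strict Implicit.
Unset Printing Implicit Defensive.

Import Order.TTheory.
Local Open Scope classical_set_scope.
Local Open Scope order_scope.

Section CompleteLattice.
Context (d : Order.disp_t) (C : tbLatticeType d).
Hypothesis C_complete : complete_lattice C.
Implicit Types (S : set C) (u : C).

Lemma bigjoin_supremums S : supremums S (bigjoin S).
Proof.
have [[s Ss] _] := C_complete S; rewrite /bigjoin /supremum.
(* On [set0] the default value [\bot] is itself the supremum; elsewhere completeness makes the
   choice inside [supremum] succeed. *)
case: ifPn => [/eqP-> | _]; last by case: xgetP => // /(_ s).
by split=> [? []|? _]; exact: le0x.
Qed.

Lemma bigmeet_infimums S : infimums S (bigmeet S).
Proof.
have [_ [s Ss]] := C_complete S; rewrite /bigmeet /infimum.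
case: ifPn => [/eqP-> | _]; last by case: xgetP => // /(_ s).
by split=> [? []|? _]; exact: lex1.
Qed.

Lemma bigjoin_ub S u : S u -> u <= bigjoin S.
Proof. exact: (bigjoin_supremums S).1. Qed.

Lemma bigjoin_le S u : (forall v, S v -> v <= u) -> bigjoin S <= u.
Proof. exact: (bigjoin_supremums S).2. Qed.

Lemma bigmeet_lb S u : S u -> bigmeet S <= u.
Proof. exact: (bigmeet_infimums S).1. Qed.

Lemma le_bigmeet S u : (forall v, S v -> u <= v) -> u <= bigmeet S.
Proof. exact: (bigmeet_infimums S).2. Qed.

End CompleteLattice.

Section JoinSubsemilattice.
Context (d : Order.disp_t) (A : tbLatticeType d) (D : set A).
Hypotheses (D0 : D \bot) (DU : forall x y, D x -> D y -> D (x `|` y)).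

(** The finite join serves as the bound. [D0] covers the empty set, which compactness may well
    return as a finite part. *)
Lemma finite_subset_ub (I : set A) :
  finite_set I -> (I `<=` D)%classic -> exists2 j, D j & ubound I j.
Proof.
move=> /finite_seqP[s ->] sD; exists (\join_(x <- s) x).
  elim: s sD => [|x s IHs] sD; first by rewrite big_nil.
  rewrite big_cons; apply: DU; first by apply: sD; rewrite /= mem_head.
  by apply: IHs => y ys; apply: sD; rewrite /= inE ys orbT.
by move=> x /= xs; exact: (joins_sup_seq id xs).
Qed.

End JoinSubsemilattice.

Section CanonicalExtensionTheory.
Context (d : Order.disp_t) (A : tbDistrLatticeType d).
Context (d' : Order.disp_t) (C : tbLatticeType d') (e : {lmorphism A -> C}).
Hypothesis e_canonical : canonical_extension e.

Let C_complete : complete_lattice C. Proof. by case: e_canonical. Qed.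

Lemma embed_bot : e \bot = \bot. Proof. by case: e_canonical => _ []. Qed.

Lemma embed_top : e \top = \top. Proof. by case: e_canonical => _ []. Qed.

(** The order is the equation [a]&[b = a], which an injective meet-preserving map both preserves and
    reflects. *)
Lemma embed_le (a b : A) : (e a <= e b) = (a <= b).
Proof.
case: e_canonical => _ [e_inj _ _] _ _.
by rewrite !leEmeet -omorphI (inj_eq e_inj).
Qed.

(** Compactness gives finite parts of [F] and [I]. Passing to a part of [F] can only raise the meet,
    and the finite part of [I] lies under a single element of [I]. *)
Lemma bigmeet_le_bigjoin_interp (F I : set A) :
    F !=set0 -> I \bot -> (forall x y, I x -> I y -> I (x `|` y)) ->
    bigmeet (e @` F)%classic <= bigjoin (e @` I)%classic ->
  exists2 j, I j & bigmeet (e @` F)%classic <= e j.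
Proof.
case: e_canonical => _ _ _ e_compact F0 I0 IU leFI.
have [F' [I' [_ F'F finI' I'I leF'I']]] :=
  e_compact F I F0 (ex_intro _ _ I0) leFI.
have [j Ij I'j] := finite_subset_ub I0 IU finI' I'I.
exists j => //; apply: le_trans (le_trans leF'I' _).
  by apply: le_bigmeet => // _ [x /F'F Fx <-]; apply: bigmeet_lb => //; exists x.
by apply: bigjoin_le => // _ [x /I'j lexj <-]; rewrite embed_le.
Qed.

Lemma embed_le_bigjoin_ideal (I : set A) (c : A) :
    I \bot -> (forall x y, I x -> I y -> I (x `|` y)) ->
    (forall x y, x <= y -> I y -> I x) ->
  e c <= bigjoin (e @` I)%classic <-> I c.
Proof.
move=> I0 IU Idown; split=> [lecI|Ic]; last by apply: bigjoin_ub => //; exists c.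
have cE : bigmeet (e @` [set c])%classic = e c.
  by rewrite image_set1 /bigmeet; apply: (is_subset1_infimums (A := [set e c]));
    [exact: bigmeet_infimums | rewrite infimums1].
(* The singleton has meet [e c], so interpolation yields [j] in [I] above [c], and down-closure
   brings [c] into [I]. *)
have [|j Ij] := @bigmeet_le_bigjoin_interp [set c] I (ex_intro _ c erefl) I0 IU.
  by rewrite cE.
by rewrite cE embed_le => /Idown; apply.
Qed.

Lemma closed_le_open_interp (k u : C) :
  closed_elt e k -> open_elt e u -> k <= u -> exists2 c, k <= e c & e c <= u.
Proof.
move=> [F F0 ->] [I _ ->] leFI.
set u' := bigjoin (e @` I)%classic in leFI *.
(* The generating set [I] need not be closed under joins. The ideal [D] of all elements of [A] below
   [u'] is, and it has the same join. *)
pose D : set A := [set c | e c <= u'].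
have u'E : u' = bigjoin (e @` D)%classic.
  apply/eqP; rewrite eq_le; apply/andP; split; apply: bigjoin_le => // _ [x xP <-] //.
  apply: bigjoin_ub => //; exists x => //.
  by apply: bigjoin_ub => //; exists x.
have [|||j Dj lej] := @bigmeet_le_bigjoin_interp F D F0.
- by rewrite /D /= embed_bot le0x.
- by move=> x y; rewrite /D /= omorphU leUx => -> ->.
- by rewrite -u'E.
by exists j.
Qed.

Lemma open_le (u v : C) :
  open_elt e u -> (forall c, e c <= u -> e c <= v) -> u <= v.
Proof.
move=> [I _ ->] leIv; apply: bigjoin_le => // _ [x Ix <-]; apply: leIv.
by apply: bigjoin_ub => //; exists x.
Qed.

(** [C] is not assumed distributive, so the meet is not known to be open and [open_le] does not
    apply. Density writes it instead as a join of closed elements, each of which is separated from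
    [u1] and from [u2] by elements of [A]. *)
Lemma open_meet_le (u1 u2 v : C) :
    open_elt e u1 -> open_elt e u2 ->
    (forall c, e c <= u1 -> e c <= u2 -> e c <= v) ->
  u1 `&` u2 <= v.
Proof.
case: e_canonical => _ _ e_dense _ u1_open u2_open leuv.
have [[S S_closed uE] _] := e_dense (u1 `&` u2).
rewrite uE; apply: bigjoin_le => // k Sk.
have: k <= u1 `&` u2 by rewrite uE; exact: bigjoin_ub.
have k_closed := S_closed k Sk.
rewrite lexI => /andP[/(closed_le_open_interp k_closed u1_open)[c1 kc1 c1u]].
move=> /(closed_le_open_interp k_closed u2_open)[c2 kc2 c2u].
(* The meet of the two separating elements is still in [A], above [k] and below both [u1] and
   [u2]. *)
apply: (@le_trans _ _ (e (c1 `&` c2))); first by rewrite omorphI lexI kc1.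
by apply: leuv; rewrite omorphI; [apply: leIxl | apply: leIxr].
Qed.

Lemma open_eq (u v : C) : open_elt e u -> open_elt e v ->
  (forall c, e c <= u <-> e c <= v) -> u = v.
Proof.
move=> u_open v_open uv.
by apply/eqP; rewrite eq_le !open_le // => c /uv.
Qed.

Lemma open_eq_meet (w u1 u2 : C) :
    open_elt e w -> open_elt e u1 -> open_elt e u2 ->
    (forall c, e c <= w <-> e c <= u1 /\ e c <= u2) ->
  w = u1 `&` u2.
Proof.
move=> w_open u1_open u2_open wu.
apply/eqP; rewrite eq_le lexI; apply/andP; split.
  by apply/andP; split; apply: open_le => // c /wu[].
by apply: open_meet_le => // c cu1 cu2; apply/wu.
Qed.

(** The elements [x] with [prec (a]&[x) b] form an ideal: closure under joins combines
    distributivity of [A] with [subord_join], and the rest is monotonicity. An ideal contains every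
    element of [A] below its join. *)
Lemma le_slanted_of_subord (prec : A -> A -> Prop) (a b c : A) :
    subordination prec ->
  e c <= slanted_of_subord e prec a b <-> prec (a `&` c) b.
Proof.
case=> prec0 _ _ precU prec_mono.
rewrite /slanted_of_subord (embed_le_bigjoin_ideal (I := [set x | prec _ _])) //=.
- by apply: (prec_mono _ \bot \bot); rewrite ?meetx0 ?le0x.
- by move=> x y px py; rewrite meetUr; exact: precU.
- by move=> x y lexy /prec_mono; apply=> //; exact: leI2.
Qed.

Lemma slanted_of_subord_open (prec : A -> A -> Prop) (a b : A) :
  subordination prec -> open_elt e (slanted_of_subord e prec a b).
Proof.
move=> subP; exists [set c | prec (a `&` c) b] => //.
exists \bot => /=; rewrite meetx0.
exact: subord_mono subP _ _ _ _ (lexx _) (subord_bot subP) (le0x _).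
Qed.

Lemma slanted_of_subord_slanted (prec : A -> A -> Prop) :
  subordination prec -> slanted_heyting e (slanted_of_subord e prec).
Proof.
move=> subP; have impP a b c := le_slanted_of_subord a b c subP.
have imp_open a b := slanted_of_subord_open a b subP.
have mono := subord_mono subP.
split=> [//|a b1 b2|a|a1 a2 b|b|a b c].
- apply: open_eq_meet => // c; rewrite !impP; split=> [p | []].
    by split; apply: mono p _; rewrite ?leIl ?leIr.
  exact: subord_meet.
(* Since [\top] of [C] is the image of [\top] of [A], being equal to it is tested by [impP] at the
   single element [\top]. *)
- apply/eqP; rewrite eq_le lex1 -embed_top /=; apply/impP.
  exact: mono (lex1 _) (subord_top subP) (lexx _).
(* Distributivity of [A] splits the left argument into a join, so that [subord_join] applies. *)
- apply: open_eq_meet => // c; rewrite !impP meetUl; split=> [p | []].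
    by split; apply: mono p (lexx _); rewrite ?leUl ?leUr.
  exact: subord_join.
- apply/eqP; rewrite eq_le lex1 -embed_top /=; apply/impP; rewrite meet0x.
  exact: mono (lexx _) (subord_bot subP) (le0x _).
- by rewrite !impP meet1x.
Qed.

Lemma subord_of_slanted_subord (imp : A -> A -> C) :
  slanted_heyting e imp -> subordination (subord_of_slanted e imp).
Proof.
move=> impP; rewrite /subord_of_slanted; split=> [||a b c|a b c|a b c d0].
- by rewrite embed_bot le0x.
- by rewrite (slanted_topr impP) lex1.
- by rewrite (slanted_meetr impP) lexI => -> ->.
- by rewrite omorphU leUx => -> ->.
- rewrite -(embed_le a) => leab lebc lecd; apply: le_trans leab (le_trans lebc _).
  (* Monotonicity in the consequent follows from preservation of meets, once [c] is written as
     [c]&[d0]. *)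
  by move/meet_idPl: lecd => <-; rewrite (slanted_meetr impP) leIr.
Qed.

Lemma subord_of_slanted_of_subord (prec : A -> A -> Prop) (a b : A) :
    subordination prec ->
  subord_of_slanted e (slanted_of_subord e prec) a b <-> prec a b.
Proof.
by move=> subP; rewrite /subord_of_slanted le_slanted_of_subord // meet1x.
Qed.

(** Both sides are open, and an element [c] of [A] is below either one exactly when
    [e (a]&[c) <= imp \top b]: on the left by the ideal property, on the right by the residuation
    axiom. *)
Lemma slanted_of_subord_of_slanted (imp : A -> A -> C) (a b : A) :
    slanted_heyting e imp ->
  slanted_of_subord e (subord_of_slanted e imp) a b = imp a b.
Proof.
move=> impP; have subP := subord_of_slanted_subord impP.
apply: open_eq => [||c]; [exact: slanted_of_subord_open|exact: slanted_open|].
by rewrite le_slanted_of_subord // (slanted_residual impP).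
Qed.

End CanonicalExtensionTheory.

Theorem proposition3p3 (d : Order.disp_t) (A : tbDistrLatticeType d)
    (d' : Order.disp_t) (C : tbLatticeType d') (e : {lmorphism A -> C})
    (prec : A -> A -> Prop) (imp : A -> A -> C) :
  canonical_extension e -> subordination prec -> slanted_heyting e imp ->
  [/\ (forall a b c : A,
         (e c <= slanted_of_subord e prec a b) <-> prec (a `&` c) b),
      slanted_heyting e (slanted_of_subord e prec),
      subordination (subord_of_slanted e imp)
    & (forall a b : A,
         subord_of_slanted e (slanted_of_subord e prec) a b <-> prec a b) /\
      (forall a b : A,
         slanted_of_subord e (subord_of_slanted e imp) a b = imp a b)].
Proof.
move=> e_canonical subP impP; split=> [a b c|||].
- exact: le_slanted_of_subord.
- exact: slanted_of_subord_slanted.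
- exact: subord_of_slanted_subord.
- split=> a b; first exact: subord_of_slanted_of_subord.
  exact: slanted_of_subord_of_slanted.
Qed.
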